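(* Let $E$ be a uniquely ergodic algebraic interval exchange transformation on $N$ intervals, of degree $n$ and maximal rank. The Sah-Arnoux-Fathi (SAF) invariant of $E$ is zero if and only if the drift vector of $E$ is zero. If $n\ge N-1$, then the drift vector, and hence the SAF invariant, are non-zero.
   Context: An interval exchange transformation (IET) on $N\ge2$ intervals is a map $E$ of $\Omega=[0,1)$ obtained by partitioning $\Omega$ into $N$ consecutive half-open intervals $\Omega_1,\dots,\Omega_N$ of positive lengths $|\Omega_i|$ and rearranging them, preserving orientation, according to a permutation $\pi$ of $\{1,\dots,N\}$ which is irreducible ($\pi\{1,\dots,k\}=\{1,\dots,k\}$ only if $k=N$). Thus $E(x)=x+\tau_i$ for $x\in\Omega_i$. $E$ is algebraic of degree $n$ if the lengths $|\Omega_i|$ generate a number field $K$ of degree $n$ over $\mathbb{Q}$. Its module is $\mathcal{M}=\{\sum_i m_i|\Omega_i|:m_i\in\mathbb{Z}\}$, which contains the $\tau_i$; $E$ has maximal rank if $\mathcal{M}$ has rank $n$. Drift vector: fix a $\mathbb{Z}$-basis of $\mathcal{M}$, let $\phi:\mathcal{M}\to\mathbb{Z}^n$ be the coordinate isomorphism, and $v_i=\phi(\tau_i)$. Then $\mathcal{S}=\sum_{i=1}^N|\Omega_i|\,v_i\in\mathbb{R}^n$. SAF invariant: the element $S=\sum_{i=1}^N|\Omega_i|\otimes\tau_i$ of the tensor product $\mathbb{R}\otimes_{\mathbb{Q}}\mathbb{R}$ of $\mathbb{Q}$-vector spaces. *)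

(* Defs.v *)
From HB Require Import structures.
From mathcomp Require Import all_boot all_order all_fingroup all_algebra all_field.
From mathcomp Require Import all_classical all_reals all_analysis.
From mathcomp Require Import ring_quotient.
From mathcomp.multinomials Require Import freeg.

Set Implicit Arguments.
Unset Strict Implicit.
Unset Printing Implicit Defensive.

Import Order.TTheory GRing.Theory Num.Theory.
Import numFieldNormedType.Exports.

Local Open Scope classical_set_scope.
Local Open Scope ring_scope.

(* The tensor product of two K-modules, as the quotient of the free abelian
   group on pairs by the subgroup generated by the bilinearity relations.
   No K-action is put on the quotient: only its additive group is used. *)
Section Tensor.
Variables (K : comNzRingType) (U V : lmodType K).

Definition pair_gen (u : U) (v : V) : {freeg (U * V)%type / int} :=
  << (u, v) >>.

Inductive tensor_null : {freeg (U * V)%type / int} -> Prop :=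
| tensor_null0 : tensor_null 0
| tensor_nullB x y : tensor_null x -> tensor_null y -> tensor_null (x - y)
| tensor_nullDl u u' v :
    tensor_null (pair_gen (u + u') v - pair_gen u v - pair_gen u' v)
| tensor_nullDr u v v' :
    tensor_null (pair_gen u (v + v') - pair_gen u v - pair_gen u v')
| tensor_nullZ k u v :
    tensor_null (pair_gen (k *: u) v - pair_gen u (k *: v)).

Definition tensor_nullb : {pred {freeg (U * V)%type / int}} :=
  fun x => `[< tensor_null x >].

Lemma tensor_nullb_zmod : zmod_closed tensor_nullb.
Proof.
split=> [|x y /asboolP nx /asboolP ny]; apply/asboolP.
  exact: tensor_null0.
exact: tensor_nullB.
Qed.

HB.instance Definition _ :=
  GRing.isZmodClosed.Build {freeg (U * V)%type / int} tensor_nullb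
    tensor_nullb_zmod.

Definition tensor : zmodType := Quotient.quot tensor_nullb.

Definition tens (u : U) (v : V) : tensor :=
  (\pi_(Quotient.quot tensor_nullb) (pair_gen u v))%qT.

End Tensor.

Definition Qspace (R : realType) : Type := R.

HB.instance Definition _ (R : realType) := GRing.Zmodule.on (Qspace R).

Section QspaceLmod.
Variable R : realType.

Definition Qscale (q : rat) (x : Qspace R) : Qspace R := (ratr q : R) * (x : R).

Lemma QscaleA a b v : Qscale a (Qscale b v) = Qscale (a * b) v.
Proof. by rewrite /Qscale rmorphM mulrA. Qed.

Lemma Qscale1 : left_id 1 Qscale.
Proof. by move=> v; rewrite /Qscale rmorph1 mul1r. Qed.

Lemma QscaleDr : right_distributive Qscale +%R.
Proof. by move=> a u v; rewrite /Qscale mulrDr. Qed.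

Lemma QscaleDl v : {morph Qscale^~ v : a b / a + b}.
Proof. by move=> a b; rewrite /Qscale rmorphD mulrDl. Qed.

HB.instance Definition _ := GRing.Zmodule_isLmodule.Build rat (Qspace R)
  QscaleA Qscale1 QscaleDr QscaleDl.

End QspaceLmod.

(* Intervals are indexed from 0; iet_perm i is the rank, in the image, of the
   interval which has rank i in the domain. *)
Record iet (R : realType) (N : nat) := Iet {
  iet_len : 'I_N -> R;
  iet_perm : 'S_N;
  iet_gt1 : (1 < N)%N;
  iet_len_gt0 : forall i, 0 < iet_len i;
  iet_len_sum : \sum_i iet_len i = 1;
  iet_irreducible : forall k : nat, (0 < k <= N)%N ->
    (iet_perm @: [set i : 'I_N | (i < k)%N] = [set i : 'I_N | (i < k)%N])%SET ->
    k = N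
}.

Section Iet.
Variables (R : realType) (N : nat) (E : iet R N).
Local Notation len := (iet_len E).
Local Notation perm := (iet_perm E).

(* left endpoints of the i-th interval and of its image *)
Definition iet_left (i : 'I_N) : R := \sum_(j : 'I_N | (j < i)%N) len j.
Definition iet_left_image (i : 'I_N) : R :=
  \sum_(j : 'I_N | (perm j < perm i)%N) len j.

Definition iet_tau (i : 'I_N) : R := iet_left_image i - iet_left i.

Definition iet_interval (i : 'I_N) : set R :=
  `[iet_left i, iet_left i + len i[.

(* extended by the identity outside [0, 1) *)
Definition iet_map (x : R) : R :=
  if [pick i | x \in iet_interval i] is Some i then x + iet_tau i else x.

(* Borel probability measures on [0, 1) are represented by the Borel
   probability measures on the line that give [0, 1) full mass. *)
Definition iet_invariant (mu : probability (measurableTypeR R) R) : Prop :=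
  mu `[0, 1[%classic = 1%E /\
  forall A : set R, measurable (A : set (measurableTypeR R)) -> A `<=` `[0, 1[ ->
    mu (`[0, 1[ `&` iet_map @^-1` A) = mu A.

Definition uniquely_ergodic : Prop :=
  exists2 mu : probability (measurableTypeR R) R, iet_invariant mu &
    forall nu : probability (measurableTypeR R) R, iet_invariant nu ->
      forall A : set (measurableTypeR R), measurable A -> nu A = mu A.

(* The number field generated by the lengths is given as an abstract extension
   L of the rationals together with an embedding in R. *)
Definition iet_algebraic (n : nat) : Prop :=
  exists (L : fieldExtType rat) (iota : {rmorphism L -> R}) (l : N.-tuple L),
    [/\ forall i, iota (tnth l i) = len i,
        (<<1 & l>> = fullv)%VS & \dim {: L} = n].

Definition iet_module : set R :=
  [set x | exists m : 'I_N -> int, x = \sum_i len i *~ m i].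

Definition SAF : tensor (Qspace R) (Qspace R) :=
  \sum_i tens (len i : Qspace R) (iet_tau i : Qspace R).

End Iet.

Definition is_Zbasis (R : realType) (M : set R) (n : nat) (b : 'I_n -> R) :=
  (forall x, M x <-> exists c : 'I_n -> int, x = \sum_j b j *~ c j) /\
  (forall c : 'I_n -> int, \sum_j b j *~ c j = 0 -> forall j, c j = 0).

Definition has_Zrank (R : realType) (M : set R) (n : nat) :=
  exists b : 'I_n -> R, is_Zbasis M b.

Definition iet_maximal_rank (R : realType) (N : nat) (E : iet R N) (n : nat) :=
  has_Zrank (iet_module E) n.

(* coordinates in the family b; junk outside the span of b *)
Definition Zcoord (R : realType) (n : nat) (b : 'I_n -> R) (x : R) : 'rV[int]_n :=
  xget (0 : 'rV[int]_n) [set c : 'rV[int]_n | x = \sum_j b j *~ c ord0 j].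

Definition drift (R : realType) (N : nat) (E : iet R N) (n : nat)
    (b : 'I_n -> R) : 'rV[R]_n :=
  \sum_i iet_len E i *: map_mx intr (Zcoord b (iet_tau E i)).

(* Main.v *)
(** Writing tau_i = sum_j v_ij b_j turns the SAF invariant into
    sum_j d_j (x) b_j, where d_j = sum_i |Omega_i| v_ij are the coordinates of
    the drift; since the b_j are independent over Q, contracting the second
    factor with a Q-linear form dual to b_j recovers d_j.

    Write M and V for the integer coordinate matrices of the lengths and of the
    translations. If the drift vanishes then M^T V = 0. As M has rank n >= N - 1,
    V has rank at most 1, so all the translations are integer multiples of one
    real number. Every orbit then stays in a finite set, hence is periodic, and
    the uniform measures on two distinct orbits contradict unique
    ergodicity. *)
From HB Require Import structures.
Require Import Defs.
From mathcomp Require Import all_boot all_order all_fingroup all_algebra all_field.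
From mathcomp Require Import all_classical all_reals all_analysis.
From mathcomp Require Import ring_quotient ring lra zify.
From mathcomp.multinomials Require Import freeg.

Import Order.TTheory GRing.Theory Num.Theory.
Local Open Scope ring_scope.

(** * Linear forms and contraction of tensors *)

Section ScalarForm.
Context {K : comNzRingType} {V : lmodType K} (f : V -> K).
Hypothesis f_scalar : scalar f.

Lemma scalar_form0 : f 0 = 0.
Proof. by rewrite -[X in f X](subrr 0) -scaleN1r addrC f_scalar mulN1r addNr. Qed.

Lemma scalar_form_sumMz (I : finType) (u : I -> V) (c : I -> int) :
  f (\sum_j u j *~ c j) = \sum_j (c j)%:~R * f (u j).
Proof.
elim/big_rec2 : _ => [|j x y _ <-]; first exact: scalar_form0.
by rewrite -scaler_int f_scalar.
Qed.

End ScalarForm.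

Section TensorTheory.
Context {K : comNzRingType} {U V : lmodType K}.

Lemma tensDl (u u' : U) (v : V) : tens (u + u') v = tens u v + tens u' v.
Proof.
rewrite /tens -pi_addr; apply/eqP; rewrite -Quotient.idealrBE opprD addrA.
by apply/asboolP; apply: tensor_nullDl.
Qed.

Lemma tensDr (u : U) (v v' : V) : tens u (v + v') = tens u v + tens u v'.
Proof.
rewrite /tens -pi_addr; apply/eqP; rewrite -Quotient.idealrBE opprD addrA.
by apply/asboolP; apply: tensor_nullDr.
Qed.

Lemma tensZ (k : K) (u : U) (v : V) : tens (k *: u) v = tens u (k *: v).
Proof.
by apply/eqP; rewrite /tens -Quotient.idealrBE; apply/asboolP; apply: tensor_nullZ.
Qed.

Lemma tensMz (m : int) (u : U) (v : V) : tens (u *~ m) v = tens u (v *~ m).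
Proof. by rewrite -!scaler_int tensZ. Qed.

Lemma tens0l (v : V) : tens (0 : U) v = 0.
Proof. by apply: (addIr (tens (0 : U) v)); rewrite -tensDl addr0 add0r. Qed.

Lemma tens0r (u : U) : tens u (0 : V) = 0.
Proof. by apply: (addIr (tens u (0 : V))); rewrite -tensDr addr0 add0r. Qed.

Lemma tens_suml (I : finType) (u : I -> U) (v : V) :
  tens (\sum_i u i) v = \sum_i tens (u i) v.
Proof.
exact: (big_morph (fun x => tens x v) (fun x y => tensDl x y v) (tens0l v)).
Qed.

Lemma tens_sumr (I : finType) (u : U) (v : I -> V) :
  tens u (\sum_i v i) = \sum_i tens u (v i).
Proof.
exact: (big_morph (fun x => tens u x) (fun x y => tensDr u x y) (tens0r u)).
Qed.

Variable f : V -> K.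
Hypothesis f_scalar : scalar f.

(** Before passing to the quotient, this contracts the second factor against [f]. The type
    [zmodule U] is [U] as a module over the integers, which are the coefficients of the free
    group. *)
Let contract : {freeg (U * V)%type / int} -> zmodule U :=
  fglift (fun p : U * V => f p.2 *: p.1 : zmodule U).

Let contractE u v : contract (pair_gen u v) = f v *: u.
Proof. by rewrite /contract /pair_gen liftU scale1r. Qed.

Let contractB x y : contract (x - y) = contract x - contract y.
Proof. exact: lift_is_additive. Qed.

Let contract0 : contract 0 = 0.
Proof. by rewrite -[X in contract X](subrr 0) contractB subrr. Qed.

Let contractD x y : contract (x + y) = contract x + contract y.
Proof. by rewrite -{1}[y]opprK contractB -[- y]sub0r contractB contract0 sub0r opprK. Qed.

Let contract_null x : tensor_null x -> contract x = 0.
Proof.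
elim=> [|y z _ y0 _ z0|u u' v|u v v'|k u v]; rewrite ?contractB ?contractE //.
- by rewrite y0 z0 subrr.
- by rewrite scalerDr -addrA -opprD subrr.
- by rewrite -[v]scale1r f_scalar mul1r scale1r scalerDl -addrA -opprD subrr.
- by rewrite -[k *: v]addr0 f_scalar scalar_form0 // addr0 scalerA mulrC subrr.
Qed.

(** A vanishing sum of tensors lifts to a formal sum in the subgroup of bilinearity relations, and
    the contraction kills that subgroup. *)
Lemma tens_sum_eq0 (I : finType) (u : I -> U) (v : I -> V) :
  \sum_i tens (u i) (v i) = 0 -> \sum_i f (v i) *: u i = 0.
Proof.
move=> s0; have /contract_null : tensor_null (\sum_i pair_gen (u i) (v i)).
  (* [Quotient.idealrBE] reads an equality of classes off a difference, hence the artificial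
     [- 0]. *)
  suff : \sum_i pair_gen (u i) (v i) - 0 \in tensor_nullb (K:=K) (U:=U) (V:=V).
    by rewrite subr0 => /asboolP.
  by rewrite Quotient.idealrBE raddf_sum raddf0; apply/eqP.
rewrite (big_morph contract contractD contract0) => {2}<-.
by apply: eq_bigr => i _; rewrite contractE.
Qed.

End TensorTheory.

(** * Separating a vector from a subspace by a linear form *)

Section LinearForm.
Local Open Scope classical_set_scope.
Context {K : fieldType} {V : lmodType K}.

(** Subspaces are plain sets because the space of interest, the reals over the rationals, has
    infinite dimension. *)
Definition linear_subset (W : set V) :=
  W 0 /\ forall a x y, W x -> W y -> W (a *: x + y).

(** Zorn's lemma gives a subspace maximal among those that contain [W] and avoid [v]; adjoining any
    further vector must then capture [v]. *)
Lemma exists_maximal_subspace {W : set V} {v : V} :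
  linear_subset W -> ~ W v ->
  exists M, [/\ linear_subset M, W `<=` M, ~ M v &
    forall x, ~ M x -> exists a, M (v - a *: x)].
Proof.
move=> sW Wv.
(* set0 is admitted because Zorn_bigcup also ranges over the empty chain. *)
pose P M := M = set0 \/ [/\ linear_subset M, W `<=` M & ~ M v].
have [F FP Ftot|M [PM Mmax]] := @Zorn_bigcup V P.
  have [[X FX [x Xx]]|noX] := pselect (exists2 X, F X & X !=set0); last first.
    left; rewrite -subset0 => y [Y FY Yy]; apply: noX.
    by exists Y => //; exists y.
  have good Y y : F Y -> Y y -> [/\ linear_subset Y, W `<=` Y & ~ Y v].
    by move=> /FP[->|].
  have [[X0 _] WX _] := good X x FX Xx.
  right; split; last 2 first.
  - by move=> w /WX Xw; exists X.
  - by move=> [Y FY Yv]; have [_ _] := good _ _ FY Yv.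
  split=> [|a y z [Y FY Yy] [Z FZ Zz]]; first by exists X.
  have [YZ|ZY] := Ftot _ _ FY FZ.
    by exists Z => //; have [[_ sZ] _ _] := good _ _ FZ Zz; apply: sZ => //; apply: YZ.
  by exists Y => //; have [[_ sY] _ _] := good _ _ FY Yy; apply: sY => //; apply: ZY.
have [M0|[sM WM Mv]] := PM.
  case: (Mmax W); first by rewrite M0; split=> // /(_ 0); apply; case: sW.
  by right; split.
exists M; split=> // x Mx; have [M0 sMl] := sM.
apply: contrapT => noa.
(* [M'] is M + K x. By [noa] it still avoids [v], and it contains [x], against maximality. *)
pose M' := [set y | exists a, M (y - a *: x)].
have MM' : M `<=` M' by move=> y My; exists 0; rewrite scale0r subr0.
apply: (Mmax M').
  split=> // /(_ x) M'x; apply/Mx/M'x.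
  by exists 1; rewrite scale1r subrr.
right; split=> //; last by move=> y /WM/MM'.
split=> [|c y z [a My] [a' Mz]]; first exact: MM'.
exists (c * a + a'); have := sMl c _ _ My Mz.
by rewrite scalerBr addrACA -opprD scalerA -scalerDl.
Qed.

(* A maximal subspace avoiding v is a complement of the line K v, so the
   coordinate along v is a linear form. *)
Lemma exists_linear_form {W : set V} {v : V} : linear_subset W -> ~ W v ->
  exists f : V -> K, [/\ scalar f, f v = 1 & forall w, W w -> f w = 0].
Proof.
move=> sW Wv; have [M [[M0 sM] WM Mv spanM]] := exists_maximal_subspace sW Wv.
have MZ a x : M x -> M (a *: x) by move=> Mx; rewrite -[a *: x]addr0; exact: sM.
have decomp x : exists a, M (x - a *: v).
  have [Mx|Mx] := pselect (M x); first by exists 0; rewrite scale0r subr0.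
  have [a Ma] := spanM _ Mx.
  have a0 : a != 0 by apply: contra_notN Mv => /eqP a0; move: Ma; rewrite a0 scale0r subr0.
  exists a^-1; have := MZ (- a^-1) _ Ma.
  by rewrite scalerBr scalerA mulNr mulVf // !scaleNr scale1r opprK addrC.
have uniq x a a' : M (x - a *: v) -> M (x - a' *: v) -> a = a'.
  move=> Ma Ma'; apply/eqP; rewrite -subr_eq0; apply: contra_notT Mv => d0.
  have := MZ (a - a')^-1 _ (sM (-1) _ _ Ma Ma').
  rewrite scaleN1r opprB addrA addrNK -scalerBl scalerA mulVf //.
  by rewrite scale1r.
have [f fP] := choice decomp.
exists f; split.
- move=> c x y; apply: uniq (fP _) _.
  have := sM c _ _ (fP x) (fP y).
  by rewrite scalerBr addrACA -opprD scalerA -scalerDl.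
- by apply: (uniq v _ _ (fP _)); rewrite scale1r subrr.
- by move=> w /WM Mw; apply: (uniq w _ _ (fP _)); rewrite scale0r subr0.
Qed.

End LinearForm.

(** * Dual forms, coordinates, and the drift against the SAF invariant *)

Section Drift.
Context {R : realType}.

Definition Zfree {n : nat} (b : 'I_n -> R) :=
  forall c : 'I_n -> int, \sum_j b j *~ c j = 0 -> forall j, c j = 0.

Lemma Zfree_inj {n : nat} {b : 'I_n -> R} (c d : 'I_n -> int) : Zfree b ->
  \sum_j b j *~ c j = \sum_j b j *~ d j -> c =1 d.
Proof.
move=> bfree cd j; apply/eqP; rewrite -subr_eq0; apply/eqP.
apply: (bfree (fun j => c j - d j)).
by under eq_bigr do rewrite mulrzBr; rewrite sumrB cd subrr.
Qed.

Lemma Qspace_scaleE (q : rat) (x : R) : q *: (x : Qspace R) = ratr q * x :> R.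
Proof. by []. Qed.

(** The rational span of the other vectors misses [b j], so some form vanishes on that span and is 1
    at [b j]. *)
Lemma Zfree_dual_form {n : nat} {b : 'I_n -> R} (j : 'I_n) : Zfree b ->
  exists f : Qspace R -> rat, scalar f /\ forall k, f (b k) = (k == j)%:R.
Proof.
move=> bfree.
(* This is the span of the other vectors with denominators cleared, so that independence over the
   integers applies. *)
pose W : set (Qspace R) := [set x : Qspace R | exists (d : int) (c : 'I_n -> int),
  [/\ d != 0, c j = 0 & (x : R) *~ d = \sum_k b k *~ c k]]%classic.
have W0 : W 0.
  by exists 1, (fun=> 0); split=> //; rewrite mul0rz big1 // => k _; rewrite mulr0z.
have sW : linear_subset W.
  split=> [|q x y [d [c [d0 cj xd]]] [e [c' [e0 c'j ye]]]]; first exact: W0.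
  (* Since x d and y e are integer combinations, this factor clears every denominator of q x + y. *)
  exists (denq q * d * e), (fun k => numq q * e * c k + denq q * d * c' k).
  split; [by rewrite !mulf_neq0 ?denq_neq0 | by rewrite cj c'j !mulr0 addr0 |].
  under eq_bigr do rewrite mulrzDr [numq q * e * _]mulrC [denq q * d * _]mulrC !mulrzA.
  rewrite big_split /= -!mulrz_suml.
  have ratr_denq : ratr q *~ denq q = (numq q)%:~R :> R.
    by rewrite /ratr -[LHS]mulrzr mulfVK // intr_eq0 denq_neq0.
  have key (X Y : R) : (ratr q * X + Y) *~ (denq q * d * e) =
      X *~ d *~ numq q *~ e + Y *~ e *~ denq q *~ d.
    rewrite mulrzDl; congr (_ + _); last by rewrite -!mulrzA; congr (_ *~ _); ring.
    by rewrite 2!mulrzA -mulrzAl ratr_denq mulrzl [X *~ d *~ _]mulrzAC.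
  rewrite -xd -ye; exact: key.
have Wbj : ~ W (b j).
  move=> [d [c [d0 cj bd]]].
  (* Moving [b j] to the other side gives an integer relation whose j-th coefficient is -d, which is
     nonzero. *)
  have /bfree/(_ j)/eqP : \sum_k b k *~ (c k - d * (k == j)%:Z) = 0.
    under eq_bigr do rewrite mulrzBr.
    rewrite sumrB -bd (bigD1 j) //= eqxx mulr1 big1 ?addr0 ?subrr // => k /negPf->.
    by rewrite mulr0 mulr0z.
  by rewrite cj eqxx mulr1 sub0r oppr_eq0 (negPf d0).
have [f [fs fj fW]] := exists_linear_form sW Wbj.
exists f; split=> // k; have [->//|kj] := eqVneq k j.
apply: fW; exists 1, (fun l => (l == k)%:Z); split=> //; first by rewrite eq_sym (negPf kj).
by rewrite (bigD1 k) //= eqxx big1 ?addr0 // => l /negPf->.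
Qed.

Context {N : nat} (E : iet R N).

Lemma iet_len_module i : iet_module E (iet_len E i).
Proof.
exists (fun k => (k == i)%:Z).
by rewrite (bigD1 i) //= eqxx big1 ?addr0 // => l /negPf->.
Qed.

Lemma iet_tau_module i : iet_module E (iet_tau E i).
Proof.
exists (fun j => (iet_perm E j < iet_perm E i)%N%:Z - (j < i)%N%:Z).
under eq_bigr do rewrite mulrzBr.
by rewrite sumrB /iet_tau /iet_left_image /iet_left [in LHS]big_mkcond;
  congr (_ - _); rewrite ?[LHS]big_mkcond; apply: eq_bigr => j _; case: ifP.
Qed.

Context {n : nat} {b : 'I_n -> R} (hb : is_Zbasis (iet_module E) b).

Lemma Zcoord_module x : iet_module E x ->
  x = \sum_j b j *~ Zcoord b x ord0 j.
Proof.
move=> /hb.1[c xE]; rewrite /Zcoord; case: xgetP => // /(_ (\row_j c j)) [] /=.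
by rewrite xE; apply: eq_bigr => j _; rewrite mxE.
Qed.

Lemma drift_coord j :
  drift E b ord0 j = \sum_i iet_len E i *~ Zcoord b (iet_tau E i) ord0 j.
Proof. by rewrite /drift summxE; apply: eq_bigr => i _; rewrite !mxE mulrzr. Qed.

Lemma drift_eq0P : drift E b = 0 <->
  forall j, \sum_i iet_len E i *~ Zcoord b (iet_tau E i) ord0 j = 0.
Proof.
split=> [d0 j|d0]; first by rewrite -drift_coord d0 mxE.
by apply/rowP=> j; rewrite drift_coord d0 mxE.
Qed.

Lemma SAF_drift : SAF E = 0 <-> drift E b = 0.
Proof.
rewrite drift_eq0P; split=> [saf0 j|d0].
  have [f [fs fb]] := Zfree_dual_form j hb.2.
  rewrite -[RHS](tens_sum_eq0 _ fs _ _ _ saf0); apply: eq_bigr => i _.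
  rewrite Qspace_scaleE {2}(Zcoord_module _ (iet_tau_module i)).
  rewrite (scalar_form_sumMz _ fs) (bigD1 j) //= fb eqxx mulr1 big1 => [|k /negPf kj].
    by rewrite addr0 ratr_int mulrC mulrzr.
  by rewrite fb kj mulr0.
(* Conversely, the integer coordinates of the translations pass to the first factor; exchanging the
   sums then puts a drift coordinate in front of each [b j]. *)
have tauE i : tens (iet_len E i : Qspace R) (iet_tau E i : Qspace R) =
    \sum_j tens (iet_len E i *~ Zcoord b (iet_tau E i) ord0 j : Qspace R) (b j : Qspace R).
  rewrite {1}(Zcoord_module _ (iet_tau_module i)) tens_sumr; apply: eq_bigr => j _.
  by rewrite -tensMz.
rewrite /SAF (eq_bigr _ (fun i _ => tauE i)) exchange_big big1 // => j _.
by rewrite -tens_suml (_ : \sum_i _ = 0) ?tens0l // d0.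
Qed.

End Drift.

(** * Vanishing drift makes the translations commensurable *)

Lemma mxrank_le1_rows {F : fieldType} {m n : nat} (A : 'M[F]_(m, n)) :
  (\rank A <= 1)%N ->
  A = 0 \/ exists i0 (r : 'I_m -> F), forall i, row i A = r i *: row i0 A.
Proof.
move=> rA; have [->|/matrix0Pn[i0 [j Aij]]] := eqVneq A 0; [by left|right].
have nz : row i0 A != 0 by apply: contraNneq Aij => /rowP/(_ j); rewrite !mxE => ->.
(* In rank at most 1, a nonzero row spans the row space. *)
have AsubR : (A <= row i0 A)%MS.
  rewrite -(mxrank_leqif_sup (row_sub i0 A)) eqn_leq rank_rV nz rA andbT.
  by have := mxrankS (row_sub i0 A); rewrite rank_rV nz.
exists i0; have [D AD] := submxP AsubR.
exists (fun i => D i 0) => i; rewrite {1}AD row_mul.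
by apply/rowP=> k; rewrite !mxE big_ord1 !mxE.
Qed.

Lemma common_denominator {I : finType} (r : I -> rat) :
  exists (d : int) (k : I -> int), d != 0 /\ forall i, (k i)%:~R = r i * d%:~R.
Proof.
exists (\prod_i denq (r i)), (fun i => numq (r i) * \prod_(j | j != i) denq (r j)).
split=> [|i]; first by apply/prodf_neq0 => i _; rewrite denq_neq0.
rewrite [in RHS](bigD1 i) //= !intrM mulrA; congr (_ * _).
by rewrite -{2}[r i]divq_num_den mulfVK // intr_eq0 denq_neq0.
Qed.

Section Commensurable.
Context {R : realType} {N n : nat} (E : iet R N) {b : 'I_n -> R}.
Hypothesis hb : is_Zbasis (iet_module E) b.

Lemma drift0_tau_commensurable : (N - 1 <= n)%N -> drift E b = 0 ->
  exists (delta : R) (k : 'I_N -> int), forall i, iet_tau E i = delta *~ k i.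
Proof.
move=> nN /(drift_eq0P E (b := b)) d0.
pose m i j := Zcoord b (iet_len E i) ord0 j.
pose v i j := Zcoord b (iet_tau E i) ord0 j.
have lenE i : iet_len E i = \sum_j b j *~ m i j.
  exact: Zcoord_module (iet_len_module _ _).
have tauE i : iet_tau E i = \sum_j b j *~ v i j.
  exact: Zcoord_module (iet_tau_module _ _).
(* The basis vectors lie in the module, hence are integer combinations of the lengths. The
   coefficients form a left inverse of [M], which therefore has rank n. *)
have /choice[c cE] (k : 'I_n) : exists ck : 'I_N -> int,
    b k = \sum_i iet_len E i *~ ck i.
  apply/hb.1; exists (fun l => (l == k)%:Z).
  by rewrite (bigD1 k) //= eqxx big1 ?addr0 // => l /negPf->.
have lincomb (a : 'I_N -> int) :
    \sum_i iet_len E i *~ a i = \sum_j b j *~ (\sum_i m i j * a i).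
  under eq_bigr do rewrite lenE mulrz_suml.
  rewrite exchange_big; apply: eq_bigr => j _ /=.
  by rewrite mulrz_sumr; apply: eq_bigr => i _; rewrite mulrzA.
pose C := \matrix_(k < n, i < N) ((c k i)%:~R : rat).
pose M := \matrix_(i < N, j < n) ((m i j)%:~R : rat).
pose V := \matrix_(i < N, j < n) ((v i j)%:~R : rat).
have CM : C *m M = 1%:M.
  apply/matrixP=> k l; rewrite !mxE.
  have /(Zfree_inj _ _ hb.2)/(_ l) : \sum_j b j *~ (\sum_i m i j * c k i) =
      \sum_j b j *~ (j == k)%:Z.
    rewrite -lincomb -cE (bigD1 k) //= eqxx big1 ?addr0 // => j /negPf->.
    by rewrite mulr0z.
  rewrite eq_sym => /(congr1 (fun z => z%:~R : rat)).
  rewrite rmorph_sum /= -pmulrn => <-.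
  by apply: eq_bigr => i _; rewrite !mxE intrM mulrC.
have VM : V^T *m M = 0.
  apply/matrixP=> k l; rewrite !mxE.
  have /(Zfree_inj _ _ hb.2)/(_ l) : \sum_j b j *~ (\sum_i m i j * v i k) =
      \sum_j b j *~ 0.
    by rewrite -lincomb d0 big1 // => j _; rewrite mulr0z.
  move=> /(congr1 (fun z => z%:~R : rat)); rewrite rmorph_sum /= mulr0z => s0.
  rewrite -[RHS]s0.
  by apply: eq_bigr => i _; rewrite !mxE intrM mulrC.
have rM : (n <= \rank M)%N by rewrite -{1}(mxrank1 rat n) -CM mxrankM_maxr.
(* By [VM] the ranks of [V] and [M] add up to at most N, and N - n is at most 1. *)
have rV : (\rank V <= 1)%N.
  by have := mulmx0_rank_max VM; rewrite mxrank_tr; lia.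
have [V0|[i0 [r rE]]] := mxrank_le1_rows V rV.
  exists 0, (fun=> 0) => i; rewrite mulr0z tauE big1 // => j _.
  have /matrixP/(_ i j)/eqP := V0.
  by rewrite !mxE intr_eq0 => /eqP->; rewrite mulr0z.
have [d [k [nzd kE]]] := common_denominator r.
have nzdR : d%:~R != 0 :> R by rewrite intr_eq0.
(* Row i of [V] is a rational multiple of row [i0]; dividing by the common denominator [d] makes all
   these factors integers. *)
exists (iet_tau E i0 / d%:~R), k => i.
apply: (mulIf nzdR); rewrite -[_ *~ k i]mulrzr mulrAC divfK //.
rewrite !mulrzr !tauE !mulrz_suml; apply: eq_bigr => j _.
rewrite -!mulrzA; congr (_ *~ _); apply: (@intr_inj rat).
have /rowP/(_ j) := rE i; rewrite !mxE => vE.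
by rewrite !intrM vE kE; ring.
Qed.

End Commensurable.

(** * Averages of Dirac masses along an orbit *)

Section OrbitMeasure.
Context {d} {T : measurableType d} {R : realType} (f : T -> T) (x : T) (p : nat).

(* p is one less than the period, so that the average is never empty. *)
Definition orbit_measure : set T -> \bar R :=
  mscale (p.+1%:R^-1)%:nng (msum (fun k => \d_(iter k f x)) p.+1).

HB.instance Definition _ := Measure.on orbit_measure.

Lemma orbit_measureE (A : set T) : orbit_measure A =
  (p.+1%:R^-1 * \sum_(k < p.+1) (iter k f x \in A)%:R)%:E.
Proof.
rewrite /orbit_measure /mscale /msum /= EFinM -sumEFin.
by congr (_ * _)%E; apply: eq_bigr => k _; rewrite diracE.
Qed.

Let orbit_measure_setT : orbit_measure setT = 1%E.
Proof.
rewrite orbit_measureE (eq_bigr (fun=> 1)) => [|k _]; last by rewrite in_setT.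
by rewrite sumr_const card_ord mulVf // pnatr_eq0.
Qed.

HB.instance Definition _ :=
  Measure_isProbability.Build _ _ _ orbit_measure orbit_measure_setT.

End OrbitMeasure.

(** * Injectivity and periodic orbits of interval exchanges *)

Section IetDynamics.
Context {R : realType} {N : nat} (E : iet R N).
Local Notation len := (iet_len E).
Local Notation perm := (iet_perm E).
Local Notation f := (iet_map E).

(** Positivity of the lengths gives the gap. This serves both to keep image intervals inside [0, 1)
    and to show that they do not overlap. *)
Lemma sum_len_le (P Q : pred 'I_N) i : subpred P Q -> Q i -> ~~ P i ->
  \sum_(j | P j) len j + len i <= \sum_(j | Q j) len j.
Proof.
move=> PQ Qi Pi; rewrite [leRHS](bigID P) /=.
have -> : \sum_(j | Q j && P j) len j = \sum_(j | P j) len j.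
  by apply: eq_bigl => j; apply: andb_idl; apply: PQ.
rewrite lerD2l (bigD1 i) ?Qi //= lerDl sumr_ge0 // => j _.
exact/ltW/iet_len_gt0.
Qed.

Lemma iet_interval_cover (x : R) : 0 <= x < 1 ->
  exists i, iet_left E i <= x < iet_left E i + len i.
Proof.
move=> /andP[x0 x1]; pose L k := \sum_(j : 'I_N | (j < k)%N) len j.
have exk : exists k, x < L k.
  by exists N; rewrite /L (eq_bigl xpredT) ?iet_len_sum // => j; rewrite ltn_ord.
(* The least k with x < L k is one more than the index of the interval containing x. *)
case: (ex_minnP exk) => [[|k]] xL kmin.
  by move: xL; rewrite /L big_pred0 // ltNge x0.
have Lkx : L k <= x by rewrite leNgt; apply/negP => /kmin; rewrite ltnn.
have kN : (k < N)%N.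
  rewrite ltnNge; apply/negP => Nk; move: Lkx.
  rewrite /L (eq_bigl xpredT) ?iet_len_sum; first by rewrite leNgt x1.
  by move=> j; rewrite (leq_trans (ltn_ord j)).
exists (Ordinal kN); apply/andP; split => //.
rewrite /iet_left -/(L k) (lt_le_trans xL) // /L (bigD1 (Ordinal kN)) /= ?ltnSn //.
rewrite addrC lerD2r le_eqVlt; apply/orP; left; apply/eqP.
by apply: eq_bigl => j; rewrite ltnS -val_eqE /= ltn_neqAle andbC.
Qed.

Lemma iet_mapP (x : R) : 0 <= x < 1 -> exists i,
  f x = x + iet_tau E i /\
  iet_left_image E i <= f x < iet_left_image E i + len i.
Proof.
move=> /iet_interval_cover[i0 xi0]; rewrite /iet_map; case: pickP => [i|/(_ i0)].
  rewrite inE /iet_interval /= in_itv /= => xi; exists i; split=> //.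
  by rewrite /iet_tau; lra.
by rewrite mem_set // /iet_interval /= in_itv.
Qed.

Lemma iet_map_stable (x : R) : 0 <= x < 1 -> 0 <= f x < 1.
Proof.
move=> /iet_mapP[i [_ fx]].
have : 0 <= iet_left_image E i by apply: sumr_ge0 => j _; exact/ltW/iet_len_gt0.
have : iet_left_image E i + len i <= 1.
  by rewrite -(iet_len_sum E); apply: sum_len_le => //; rewrite ltnn.
by lra.
Qed.

(** The image intervals follow one another in the order of [perm], so equal images come from one
    interval, on which the map is a translation. *)
Lemma iet_map_inj (x y : R) : 0 <= x < 1 -> 0 <= y < 1 -> f x = f y -> x = y.
Proof.
move=> /iet_mapP[i [fx xi]] /iet_mapP[j [fy yj]] fxy.
have sep k l : (perm k < perm l)%N ->
    iet_left_image E k + len k <= iet_left_image E l.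
  by move=> kl; apply: sum_len_le => [m /ltn_trans|//|]; [exact | rewrite ltnn].
have [/sep|/sep|/val_inj/perm_inj ij] := ltngtP (perm i) (perm j); try lra.
by move: fxy; rewrite fx fy ij => /addIr.
Qed.

Lemma iet_iter_stable k (x : R) : 0 <= x < 1 -> 0 <= iter k f x < 1.
Proof. by move=> x01; elim: k => //= k; exact: iet_map_stable. Qed.

Lemma iet_iter_inj k (x y : R) : 0 <= x < 1 -> 0 <= y < 1 ->
  iter k f x = iter k f y -> x = y.
Proof.
move=> x01 y01; elim: k => //= k IH /iet_map_inj H.
by apply/IH/H; exact: iet_iter_stable.
Qed.

(** Only finitely many points of x + delta Z lie in [0, 1), so the orbit repeats itself; injectivity
    then puts x itself on the cycle. *)
Lemma commensurable_periodic {delta : R} {k : 'I_N -> int} :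
  (forall i, iet_tau E i = delta *~ k i) ->
  forall x, 0 <= x < 1 -> exists p, iter p.+1 f x = x.
Proof.
move=> tauE x x01.
have /choice[c cE] m : exists cm : int, iter m f x = x + delta *~ cm.
  elim: m => [|m [c mE]] /=; first by exists 0; rewrite mulr0z addr0.
  have [i [fE _]] := iet_mapP _ (iet_iter_stable m _ x01).
  by exists (c + k i); rewrite fE mE tauE mulrzDr addrA.
(* If delta = 0 then x is fixed, and p = 0 stands for period 1. *)
have [d0|d0] := eqVneq delta 0; first by exists 0%N; rewrite cE d0 mul0rz addr0.
(* Two points of [0, 1) differ by less than 1, so each |c m| is below 1/|delta|. *)
have [B cB] : exists B : nat, forall m, (`|c m| < B)%N.
  exists (Num.bound `|delta|^-1) => m.
  have c1 : `|c m|%:~R * `|delta| < 1.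
    rewrite intr_norm -normrM mulrzl.
    by have := iet_iter_stable m _ x01; rewrite cE ltr_norml; lra.
  have : `|c m|%:~R < `|delta|^-1 by rewrite -[ltRHS]div1r ltr_pdivlMr ?normr_gt0.
  move=> /lt_trans/(_ (archi_boundP (ltW (_ : 0 < `|delta|^-1)))).
  by rewrite invr_gt0 normr_gt0 d0 -abszE ltr_nat; apply.
have [i [j [ij cij]]] : exists i j, (i < j)%N /\ c i = c j.
  apply: contrapT => noij.
  (* Shifted by B, the values of [c] lie in [0, 2B), so 2B + 1 iterates force a repetition. *)
  have hlt m : (absz (c m + B%:Z)%R < B.*2)%N by have := cB m; lia.
  have /leq_card : injective (fun m : 'I_(B.*2.+1) => Ordinal (hlt m)).
    move=> i j /(congr1 val) /= cij; apply: val_inj => /=.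
    have {}cij : c i = c j by have := cB i; have := cB j; lia.
    by have [ij|ji|//] := ltngtP i j; exfalso; apply: noij; [exists i, j|exists j, i].
  by rewrite !card_ord ltnn.
exists (j - i).-1; rewrite prednK ?subn_gt0 //.
apply: (iet_iter_inj i) => //; first exact: iet_iter_stable.
by rewrite -iterD subnKC ?(ltnW ij) // !cE cij.
Qed.

(** * Invariant measures on periodic orbits and failure of unique ergodicity *)

Definition iet_orbit_measure (x : R) (p : nat) : probability (measurableTypeR R) R :=
  @orbit_measure _ (measurableTypeR R) R f x p.

Lemma iet_orbit_measureE (x : R) (p : nat) (A : set R) :
  iet_orbit_measure x p A =
  (p.+1%:R^-1 * \sum_(k < p.+1) (iter k f x \in A)%:R)%:E.
Proof. exact: orbit_measureE. Qed.

(** Pulling back shifts the orbit by one step. The two sums differ only in their end terms, which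
    agree because x returns after p + 1 steps; this period need not be the least one. *)
Lemma iet_orbit_measure_invariant (x : R) (p : nat) : 0 <= x < 1 ->
  iter p.+1 f x = x -> iet_invariant E (iet_orbit_measure x p).
Proof.
move=> x01 xp; split=> [|A _ A01]; rewrite !iet_orbit_measureE.
  rewrite (eq_bigr (fun=> 1)) => [|k _].
    by rewrite sumr_const card_ord mulVf // pnatr_eq0.
  by rewrite mem_set //= in_itv /= iet_iter_stable.
congr ((_ * _)%:E).
rewrite (eq_bigr (fun k : 'I_p.+1 => (iter k.+1 f x \in A)%:R)) => [|k _].
  by rewrite big_ord_recr [RHS]big_ord_recl addrC xp.
congr ((nat_of_bool _)%:R); apply/idP/idP; rewrite !inE; first by move=> [].
move=> Afx; split=> //=.
by rewrite in_itv /= iet_iter_stable.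
Qed.

(** Singletons suffice to tell the measures of two orbits apart. *)
Lemma iet_orbit_measure_set1 (x y : R) (p : nat) :
  iet_orbit_measure x p [set y]%classic = 0%E <-> y \notin traject f x p.+1.
Proof.
rewrite iet_orbit_measureE; split=> [/eqP|yx].
  rewrite eqe mulf_eq0 invr_eq0 pnatr_eq0 orFb psumr_eq0 => [/allP y0|k _]; last first.
    by rewrite ler0n.
  apply/negP => /trajectP[k kp yE].
  by have := y0 (Ordinal kp) (mem_index_enum _); rewrite /= -yE mem_set ?oner_eq0.
rewrite big1 ?mulr0 // => k _; rewrite memNset // => yE.
by move/negP: yx; apply; apply/trajectP; exists k.
Qed.

Lemma commensurable_not_uniquely_ergodic {delta : R} {k : 'I_N -> int} :
  (forall i, iet_tau E i = delta *~ k i) -> ~ uniquely_ergodic E.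
Proof.
move=> tauE [mu _ muU].
have x01 : 0 <= (0 : R) < 1 by rewrite lexx ltr01.
have [p xp] := commensurable_periodic tauE _ x01.
have [y y01 yx] : exists2 y : R, 0 <= y < 1 & y \notin traject f 0 p.+1.
  apply: contrapT => noy.
  (* The p + 2 distinct points 1/2, ..., 1/(p + 3) of [0, 1) cannot all lie among the p + 1 points
     of the orbit of 0. *)
  pose s := [seq (m.+2%:R : R)^-1 | m : nat <- iota 0 p.+2].
  have : (size s <= size (traject f 0%R p.+1))%N.
    apply: uniq_leq_size => [|y /mapP[m _ ->]].
      by rewrite map_inj_uniq ?iota_uniq // => a b /invr_inj/eqP; rewrite eqr_nat => /eqP[].
    apply/negPn/negP => my; apply: noy; exists m.+2%:R^-1 => //.
    by rewrite invr_ge0 ler0n invf_lt1 ?ltr0n // ltr1n.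
  by rewrite size_map size_iota size_traject ltnn.
have [q yq] := commensurable_periodic tauE _ y01.
have xy := muU _ (iet_orbit_measure_invariant _ _ x01 xp) [set y]%classic (measurable_set1 y).
have yy := muU _ (iet_orbit_measure_invariant _ _ y01 yq) [set y]%classic (measurable_set1 y).
(* Uniqueness would make the orbit measure of y vanish at y, as that of 0 does, although y lies on
   its own orbit. *)
have /(iet_orbit_measure_set1 y y q).1 : iet_orbit_measure y q [set y]%classic = 0%E.
  by rewrite yy -xy; apply/iet_orbit_measure_set1.
by rewrite inE eqxx.
Qed.

End IetDynamics.

Theorem proposition5 (R : realType) (N n : nat) (E : iet R N) (b : 'I_n -> R)
    (hue : uniquely_ergodic E) (halg : iet_algebraic E n)
    (hrank : iet_maximal_rank E n) (hb : is_Zbasis (iet_module E) b) :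
  (SAF E = 0 <-> drift E b = 0) /\
  ((N - 1 <= n)%N -> drift E b <> 0 /\ SAF E <> 0).
Proof.
have drift_neq0 : (N - 1 <= n)%N -> drift E b <> 0.
  move=> nN /(drift0_tau_commensurable E hb nN)[delta [k tauE]].
  exact: commensurable_not_uniquely_ergodic tauE hue.
split=> [|nN]; first exact: SAF_drift.
by split; [exact: drift_neq0 | move=> /(SAF_drift E hb).1; exact: drift_neq0].
Qed.
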